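(* If $G$ is a graph of order $n$ with adjacency matrix $A$, then $G$ forces equality in the inequality $$\|G\|_{*}\le \frac{n\sqrt n}{2}+\frac n2$$ (which is valid for every graph of order $n$) if and only if the matrix $H:=2A-J_n$ is a regular symmetric Hadamard matrix, with $-1$ along the main diagonal.
   Context: Graphs are finite, simple and undirected. $\|G\|_*$ is the energy of $G$, i.e. the trace norm (sum of singular values, equivalently sum of absolute values of the eigenvalues) of its adjacency matrix. $J_n$ is the $n\times n$ all-ones matrix. An Hadamard matrix of order $n$ is an $n\times n$ matrix $H$ with entries of modulus $1$ such that $HH^*=nI_n$, where $H^*$ is the conjugate transpose of $H$ and $I_n$ is the identity matrix of order $n$. A matrix is called regular if its row sums are equal, and so are its column sums.
   Formalization: The formal statement additionally requires the common row sum of H to be positive; without this the ''if'' direction fails, e.g. for G = K_1 (energy 0, bound 1) and G = 2K_2 (energy 4, bound 6). *)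

(* Defs.v *)
From mathcomp Require Import all_boot all_order all_algebra.

Set Implicit Arguments.
Unset Strict Implicit.
Unset Printing Implicit Defensive.

Import Order.TTheory GRing.Theory Num.Theory.
Local Open Scope ring_scope.
Local Open Scope sesquilinear_scope.

Section Defs.
Variable C : numClosedFieldType.

Definition adjacency_mx (n : nat) (e : rel 'I_n) : 'M[C]_n :=
  \matrix_(i, j) (e i j)%:R.

(* The singular values of M are the square roots of the eigenvalues of M^* M,
   counted with multiplicity. [spectral_diag] is only meaningful on normal
   matrices, and M^* M is always Hermitian. *)
Definition singular_value (n : nat) (M : 'M[C]_n) (i : 'I_n) : C :=
  sqrtC (spectral_diag (M^t* *m M) 0 i).

Definition trace_norm (n : nat) (M : 'M[C]_n) : C :=
  \sum_(i < n) singular_value M i.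

Definition energy (n : nat) (e : rel 'I_n) : C := trace_norm (adjacency_mx e).

Definition hadamard_mx (n : nat) (H : 'M[C]_n) : Prop :=
  (forall i j, `|H i j| = 1) /\ H *m H^t* = n%:R%:M.

Definition regular_mx (m n : nat) (M : 'M[C]_(m, n)) : Prop :=
  (forall i i', \sum_j M i j = \sum_j M i' j) /\
  (forall j j', \sum_i M i j = \sum_i M i j').

End Defs.

Arguments adjacency_mx C {n} e.
Arguments energy C {n} e.

(* Main.v *)
Require Import Defs.
From mathcomp Require Import all_boot all_order all_algebra.
From mathcomp Require Import ring.

Set Implicit Arguments.
Unset Strict Implicit.
Unset Printing Implicit Defensive.

Import Order.TTheory GRing.Theory Num.Theory.
Local Open Scope sesquilinear_scope.
Local Open Scope ring_scope.

(** Write s for the square root of n and 1 for the all-ones column, so that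
    2A = H + 1 1^*, where H has unimodular entries.  By polar decomposition the
    trace norm of A is tr(UA) for some partial isometry U, and
    2 tr(UA) = tr(UH) + 1^* U 1.  Cauchy-Schwarz bounds the first term by
    |U| |H| <= s n (Frobenius norms) and the second one by |1|^2 = n, which is
    the inequality.

    To reach the equality case as well, both estimates are turned into a single
    identity ([trace_norm_gap]): 4 s (bound - trace norm of A) equals

      s |U1 - 1|^2 + s |1 - U^*U 1|^2 + |s U - H^*|^2 + n |I - U U^*|^2.

    Equality thus means that U is unitary, that H^* = s U, and that U fixes 1;
    hence H H^* = n I and H^* 1 = s 1.  Conversely, if these two relations hold
    then U = H^*/s is unitary, tr(UA) equals the bound, and |tr(UA)| is at most
    the trace norm of A ([unitary_mxtrace_le]).  [trace_norm_sign_eq] records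
    this equivalence for every complex A and H with 2A = H + J and H unimodular.

    For a graph, H = H^*, and what remains is to see that a Hermitian H with
    H^2 = n I and constant positive row sum r has r = s: applying H twice to 1
    gives r^2 = n. *)

(** * Adjoints and the Frobenius norm *)

Definition frob2 (C : numClosedFieldType) (m n : nat) (X : 'M[C]_(m, n)) : C :=
  \tr (X *m X^t*).

Lemma adjmxM (C : numClosedFieldType) (m n p : nat) (X : 'M[C]_(m, n))
    (Y : 'M[C]_(n, p)) : (X *m Y)^t* = Y^t* *m X^t*.
Proof. by rewrite trmx_mul map_mxM. Qed.

Lemma adjmxB (C : numClosedFieldType) (m n : nat) (X Y : 'M[C]_(m, n)) :
  (X - Y)^t* = X^t* - Y^t*.
Proof. by rewrite linearB /= map_mxB. Qed.

Lemma adjmxZ (C : numClosedFieldType) (m n : nat) (a : C) (X : 'M[C]_(m, n)) :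
  (a *: X)^t* = a^* *: X^t*.
Proof. by rewrite linearZ /= map_mxZ. Qed.

Lemma adjmx1 (C : numClosedFieldType) (n : nat) : (1%:M : 'M[C]_n)^t* = 1%:M.
Proof. by rewrite trmx1 map_mx1. Qed.

Lemma mxtrace_adj (C : numClosedFieldType) (n : nat) (X : 'M[C]_n) :
  \tr (X^t*) = (\tr X)^*.
Proof. by rewrite trace_map_mx mxtrace_tr. Qed.

Lemma frob2E (C : numClosedFieldType) (m n : nat) (X : 'M[C]_(m, n)) :
  frob2 X = \sum_i \sum_j `|X i j| ^+ 2.
Proof.
apply: eq_bigr => i _; rewrite mxE; apply: eq_bigr => j _.
by rewrite !mxE normCK.
Qed.

Lemma frob2_ge0 (C : numClosedFieldType) (m n : nat) (X : 'M[C]_(m, n)) :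
  0 <= frob2 X.
Proof.
by rewrite frob2E; do 2 apply: sumr_ge0 => ? _; rewrite exprn_ge0.
Qed.

Lemma frob2_eq0 (C : numClosedFieldType) (m n : nat) (X : 'M[C]_(m, n)) :
  frob2 X = 0 -> X = 0.
Proof.
rewrite frob2E => X0; apply/matrixP => i j; rewrite mxE.
have sq_ge0 k l : 0 <= `|X k l| ^+ 2 by rewrite exprn_ge0.
have Xi0 : \sum_l `|X i l| ^+ 2 = 0.
  by apply: (psumr_eq0P _ X0) => // k _; apply: sumr_ge0.
have /eqP : `|X i j| ^+ 2 = 0 by apply: (psumr_eq0P _ Xi0).
by rewrite sqrf_eq0 normr_eq0 => /eqP.
Qed.

Lemma frob2_adj (C : numClosedFieldType) (m n : nat) (X : 'M[C]_(m, n)) :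
  frob2 (X^t*) = frob2 X.
Proof. by rewrite /frob2 trmxCK mxtrace_mulC. Qed.

Lemma frob2Z (C : numClosedFieldType) (m n : nat) (a : C) (X : 'M[C]_(m, n)) :
  frob2 (a *: X) = `|a| ^+ 2 * frob2 X.
Proof.
rewrite /frob2 adjmxZ -scalemxAl -scalemxAr !mxtraceZ.
by rewrite mulrA normCK.
Qed.

Lemma frob2B (C : numClosedFieldType) (m n : nat) (X Y : 'M[C]_(m, n)) :
  frob2 (X - Y) = frob2 X + frob2 Y - (\tr (X *m Y^t*) + (\tr (X *m Y^t*))^*).
Proof.
rewrite /frob2 -mxtrace_adj adjmxM trmxCK adjmxB mulmxBl !mulmxBr !linearB /=.
ring.
Qed.

Lemma frob2_const1 (C : numClosedFieldType) (n : nat) :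
  frob2 (const_mx 1 : 'cV[C]_n) = n%:R.
Proof.
rewrite frob2E (eq_bigr (fun=> 1)) ?sumr_const ?card_ord // => i _.
by rewrite big_ord1 mxE normr1 expr1n.
Qed.

(** U^*U is the orthogonal projection onto the initial space of U, on which U is
    isometric: this is Pythagoras for the component of Z outside that space. *)
Lemma frob2_partial_isometry (C : numClosedFieldType) (m n p : nat)
    (U : 'M[C]_(m, n)) (Z : 'M[C]_(n, p)) :
  U *m U^t* *m U = U -> frob2 (Z - U^t* *m U *m Z) = frob2 Z - frob2 (U *m Z).
Proof.
move=> pU; rewrite frob2B.
have -> : \tr (Z *m (U^t* *m U *m Z)^t*) = frob2 (U *m Z).
  rewrite /frob2 !adjmxM trmxCK [RHS]mxtrace_mulC !mulmxA.
  by rewrite mxtrace_mulC !mulmxA.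
have -> : frob2 (U^t* *m U *m Z) = frob2 (U *m Z).
  rewrite -mulmxA /frob2 [(U^t* *m _)^t*]adjmxM trmxCK mulmxA mxtrace_mulC.
  by rewrite !mulmxA pU.
rewrite (CrealP (ger0_real (frob2_ge0 _))); ring.
Qed.

(** * Singular values *)

(** A maps an orthonormal eigenbasis of A^*A to orthogonal vectors, whose squared
    lengths are the eigenvalues. *)
Lemma gram_spectral (C : numClosedFieldType) (n : nat) (A : 'M[C]_n) :
  let Q := spectralmx (A^t* *m A) in
  (A *m Q^t*)^t* *m (A *m Q^t*) = diag_mx (spectral_diag (A^t* *m A)).
Proof.
set S := A^t* *m A => Q; have uQ : Q \is unitarymx := spectral_unitarymx S.
have /orthomx_spectralP : S \is normalmx.
  by apply/normalmxP; rewrite /S adjmxM trmxCK.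
rewrite (invmx_unitary uQ) -/Q => defS.
rewrite adjmxM trmxCK -mulmxA (mulmxA (A^t*)) -/S [in LHS]defS !mulmxA.
by rewrite (unitarymxP uQ) mul1mx mulmxtVK.
Qed.

Lemma singular_value_ge0 (C : numClosedFieldType) (n : nat) (A : 'M[C]_n) i :
  0 <= singular_value A i.
Proof.
rewrite sqrtC_ge0.
have -> : spectral_diag (A^t* *m A) 0 i =
    diag_mx (spectral_diag (A^t* *m A)) i i.
  by rewrite mxE eqxx.
rewrite -gram_spectral mxE sumr_ge0 // => j _.
by rewrite !mxE mulrC mul_conjC_ge0.
Qed.

Lemma right_singular_basis (C : numClosedFieldType) (n : nat) (A : 'M[C]_n) :
  exists2 Q : 'M[C]_n, Q \is unitarymx &
    (A *m Q^t*)^t* *m (A *m Q^t*) = diag_mx (\row_i singular_value A i ^+ 2).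
Proof.
exists (spectralmx (A^t* *m A)); first exact: spectral_unitarymx.
by rewrite gram_spectral; congr diag_mx; apply/rowP => i; rewrite mxE sqrtCK.
Qed.

(** The partial isometry is the adjoint of the phase in the polar decomposition
    of A: with q_i the right singular vectors, it sends A q_i / |A q_i| back to
    q_i whenever A q_i is nonzero, and it kills the complement of the range of A.
    A unitary phase would require a choice of completion for singular A. *)
Lemma polar_partial_isometry (C : numClosedFieldType) (n : nat) (A : 'M[C]_n) :
  exists2 U : 'M[C]_n, U *m U^t* *m U = U & \tr (U *m A) = trace_norm A.
Proof.
have [Q uQ] := right_singular_basis A.
move defB: (A *m Q^t*) => B gramB.
(* Zero singular values need no special treatment, since 0^-1 = 0. *)
pose d := \row_i (singular_value A i)^-1.
have adj_d : (diag_mx d)^t* = diag_mx d.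
  rewrite tr_diag_mx map_diag_mx; congr diag_mx; apply/rowP => i; rewrite !mxE.
  by apply: geC0_conj; rewrite invr_ge0 singular_value_ge0.
exists (Q^t* *m diag_mx d *m B^t*).
  have QVQ : Q *m Q^t* = 1%:M by apply/unitarymxP.
  rewrite !adjmxM !trmxCK adj_d -!mulmxA; congr (_ *m _).
  rewrite (mulmxA Q) QVQ mul1mx (mulmxA (B^t*)) gramB !mulmxA; congr (_ *m _).
  rewrite !mulmx_diag; congr diag_mx; apply/rowP => i; rewrite !mxE.
  have [->|nz] := eqVneq (singular_value A i) 0; first by rewrite invr0 !mulr0.
  by field.
rewrite -!mulmxA mxtrace_mulC -!mulmxA defB gramB mulmx_diag mxtrace_diag.
apply: eq_bigr => i _; rewrite !mxE.
have [->|nz] := eqVneq (singular_value A i) 0; first by rewrite expr0n mulr0.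
by field.
Qed.

(** In the basis Q of right singular vectors, the i-th diagonal entry of the
    trace pairs a unit vector with A q_i, whose length is the i-th singular
    value. *)
Lemma unitary_mxtrace_le (C : numClosedFieldType) (n : nat) (U A : 'M[C]_n) :
  U \is unitarymx -> `|\tr (U *m A)| <= trace_norm A.
Proof.
move=> uU; have [Q uQ] := right_singular_basis A.
move defB: (A *m Q^t*) => B gramB.
have -> : \tr (U *m A) = \tr (Q *m U *m B).
  by rewrite -defB [RHS]mxtrace_mulC mulmxA mulmxKtV // mxtrace_mulC.
apply: (le_trans (ler_norm_sum _ _ _)); apply: ler_sum => i _.
have -> : (Q *m U *m B) i i = dotmx (row i (Q *m U)) (row i (B^t*)).
  by rewrite dotmxE !mxE; apply: eq_bigr => j _; rewrite !mxE conjCK.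
set u := row i _; set v := row i _.
have le_uv : `|dotmx u v| <= sqrtC (dotmx u u) * sqrtC (dotmx v v).
  by case: (CauchySchwarz_sqrt (@dotmx C n) u v).
apply: (le_trans le_uv).
have -> : dotmx u u = 1.
  have /row_unitarymxP -> : Q *m U \is unitarymx by exact: mul_unitarymx.
  by rewrite eqxx.
have -> : dotmx v v = singular_value A i ^+ 2.
  have := congr1 (fun M : 'M_n => M i i) gramB; rewrite !mxE eqxx mulr1n => <-.
  by rewrite dotmxE !mxE; apply: eq_bigr => j _; rewrite !mxE conjCK.
by rewrite sqrtC1 mul1r sqrCK // singular_value_ge0.
Qed.

(** * Matrices of the form (H + J) / 2 with H unimodular *)

Lemma const_mx1E (C : numClosedFieldType) (n : nat) :
  (const_mx 1 : 'M[C]_n) = (const_mx 1 : 'cV_n) *m (const_mx 1 : 'cV_n)^t*.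
Proof.
by apply/matrixP => i j; rewrite !mxE big_ord1 !mxE mul1r; apply/esym/conjC1.
Qed.

Lemma frob2_unimodular (C : numClosedFieldType) (n : nat) (H : 'M[C]_n) :
  (forall i j, `|H i j| = 1) -> frob2 H = n%:R ^+ 2.
Proof.
move=> H_unimodular; rewrite frob2E (eq_bigr (fun=> n%:R)) => [|i _].
  by rewrite sumr_const card_ord expr2 mulr_natr.
rewrite (eq_bigr (fun=> 1)) => [|j _]; last by rewrite H_unimodular expr1n.
by rewrite sumr_const card_ord.
Qed.

(** Expand the four squares.  The two involving the all-ones vector add up to
    2n - 2 Re(1^* U 1), because the terms |U1|^2 cancel.  In the other two the
    terms n |U|^2 cancel, which leaves 2n^2 - 2 s Re tr(UH).  The real parts
    recombine into the trace norm, because tr(UA) is real. *)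
Lemma trace_norm_gap (C : numClosedFieldType) (n : nat) (A H U : 'M[C]_n) :
    let one : 'cV[C]_n := const_mx 1 in
    let bound : C := n%:R * sqrtC n%:R / 2 + n%:R / 2 in
    2 *: A = H + const_mx 1 -> (forall i j, `|H i j| = 1) ->
    U *m U^t* *m U = U -> \tr (U *m A) = trace_norm A ->
  4 * sqrtC n%:R * (bound - trace_norm A) =
    sqrtC n%:R * frob2 (U *m one - one)
    + sqrtC n%:R * frob2 (one - U^t* *m U *m one)
    + frob2 (sqrtC n%:R *: U - H^t*) + n%:R * frob2 (1%:M - U *m U^t*).
Proof.
move=> one bound AH H_unimodular pU trUA.
(* U^* is a partial isometry too, and its initial projection is U U^*. *)
have pUa : U^t* *m U^t*^t* *m U^t* = U^t*.
  by rewrite -[in RHS]pU !adjmxM trmxCK mulmxA.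
have gapI : frob2 (1%:M - U *m U^t*) = n%:R - frob2 U.
  have := frob2_partial_isometry 1%:M pUa.
  rewrite trmxCK !mulmx1 frob2_adj => ->.
  by rewrite /frob2 adjmx1 mulmx1 mxtrace1.
have s_real : (sqrtC n%:R : C)^* = sqrtC n%:R by rewrite geC0_conj ?sqrtC_ge0.
have E_real : (trace_norm A)^* = trace_norm A.
  by rewrite geC0_conj ?sumr_ge0 // => i _; rewrite singular_value_ge0.
have trU : \tr (U *m H) + \tr (U *m one *m one^t*) = 2 * trace_norm A.
  rewrite -trUA -mulmxA -const_mx1E -mxtraceD -mulmxDr -AH -scalemxAr.
  by rewrite mxtraceZ.
have trUc : (\tr (U *m H))^* + (\tr (U *m one *m one^t*))^* = 2 * trace_norm A.
  by rewrite -rmorphD trU rmorphM /= E_real rmorph_nat.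
rewrite (frob2_partial_isometry _ pU) gapI !frob2B frob2Z frob2_adj.
rewrite (frob2_unimodular H_unimodular) frob2_const1 trmxCK -scalemxAl mxtraceZ.
rewrite rmorphM /= s_real normCK s_real -expr2 sqrtCK.
have nE : n%:R = sqrtC n%:R ^+ 2 :> C by rewrite sqrtCK.
move: trU trUc => /(canRL (addrK _)) -> /(canRL (addrK _)) ->.
rewrite /bound; move: (sqrtC n%:R) nE => s ->.
by field.
Qed.

Lemma trace_norm_sign_le (C : numClosedFieldType) (n : nat) (A H : 'M[C]_n) :
    2 *: A = H + const_mx 1 -> (forall i j, `|H i j| = 1) ->
  trace_norm A <= n%:R * sqrtC n%:R / 2 + n%:R / 2.
Proof.
move=> AH H1; case: (posnP n) => [n0|n_gt0].
  move: A H AH H1; rewrite n0 => A *.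
  by rewrite /trace_norm big_ord0 !mul0r addr0.
have [U pU trU] := polar_partial_isometry A.
have s_gt0 : 0 < sqrtC n%:R :> C by rewrite sqrtC_gt0 ltr0n.
have gap := trace_norm_gap AH H1 pU trU.
rewrite -subr_ge0 -(pmulr_rge0 _ (_ : 0 < 4 * sqrtC n%:R)) ?mulr_gt0 //.
by rewrite gap !addr_ge0 // ?mulr_ge0 ?frob2_ge0 // ltW.
Qed.

(** At equality each of the four squares of [trace_norm_gap] vanishes, their
    weights s, s, 1, n being positive.  For n = 0 the weights vanish, but then
    both sides hold trivially. *)
Lemma trace_norm_sign_eq (C : numClosedFieldType) (n : nat) (A H : 'M[C]_n) :
    let one : 'cV[C]_n := const_mx 1 in
    2 *: A = H + const_mx 1 -> (forall i j, `|H i j| = 1) ->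
  trace_norm A = n%:R * sqrtC n%:R / 2 + n%:R / 2 <->
  H *m H^t* = n%:R%:M /\ H^t* *m one = sqrtC n%:R *: one.
Proof.
move=> one AH H1; case: (posnP n) => [n0|n_gt0].
  move: A H AH H1 @one; rewrite n0 => A H *.
  rewrite /trace_norm big_ord0 !mul0r addr0.
  by split=> // _; split; apply/matrixP => -[].
have s_gt0 : 0 < sqrtC n%:R :> C by rewrite sqrtC_gt0 ltr0n.
have s_neq0 := lt0r_neq0 s_gt0.
have n_neq0 : n%:R != 0 :> C by rewrite pnatr_eq0 -lt0n.
have sK : sqrtC n%:R * sqrtC n%:R = n%:R :> C by rewrite -expr2 sqrtCK.
have s_real : (sqrtC n%:R : C)^* = sqrtC n%:R by rewrite geC0_conj ?sqrtC_ge0.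
split=> [eqE | [HH H_one]].
  have [U pU trU] := polar_partial_isometry A.
  have := trace_norm_gap AH H1 pU trU.
  rewrite eqE subrr mulr0 => /esym/eqP.
  rewrite !paddr_eq0 ?addr_ge0 ?mulr_ge0 ?frob2_ge0 ?(ltW s_gt0) //.
  rewrite !mulf_eq0 (negPf s_neq0) (negPf n_neq0) /=.
  move=> /andP[/andP[/andP[/eqP/frob2_eq0/subr0_eq U1 _]]].
  move=> /eqP/frob2_eq0/subr0_eq sU /eqP/frob2_eq0/subr0_eq/esym UU.
  rewrite -sU -scalemxAl U1; split=> //.
  rewrite -[H]trmxCK -sU adjmxZ s_real -scalemxAl -scalemxAr scalerA.
  by rewrite sK (mulmx1C UU) scale_scalar_mx mulr1.
apply/le_anti/andP; split; first exact: trace_norm_sign_le AH H1.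
(* The only candidate: at equality s U = H^*, as the first half has shown. *)
pose U := (sqrtC n%:R)^-1 *: H^t*.
have HH' : H^t* *m H = n%:R%:M.
  have : (n%:R^-1 *: H) *m H^t* = 1%:M.
    by rewrite -scalemxAl HH scale_scalar_mx mulVf.
  move=> /mulmx1C; rewrite -scalemxAr => /(congr1 ( *:%R n%:R)).
  by rewrite scalerA divff // scale1r scale_scalar_mx mulr1.
have uU : U \is unitarymx.
  apply/unitarymxP; rewrite /U adjmxZ trmxCK -scalemxAl -scalemxAr.
  rewrite HH' scalerA scale_scalar_mx fmorphV /= s_real -invfM sK.
  by rewrite mulVf.
have := unitary_mxtrace_le A uU.
suff -> : \tr (U *m A) = n%:R * sqrtC n%:R / 2 + n%:R / 2.
  rewrite ger0_norm //.
  by rewrite addr_ge0 ?divr_ge0 ?mulr_ge0 ?sqrtC_ge0 ?ler0n.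
have -> : A = 2^-1 *: (H + const_mx 1).
  by rewrite -AH scalerA mulVf ?pnatr_eq0 // scale1r.
rewrite -scalemxAr mxtraceZ /U -scalemxAl mxtraceZ mulmxDr mxtraceD HH'.
rewrite mxtrace_scalar const_mx1E mulmxA H_one -scalemxAl mxtraceZ.
rewrite -/(frob2 _) frob2_const1 -[n%:R *+ n]mulr_natr.
move: (sqrtC n%:R) s_neq0 sK => s s_neq0 <-.
by field.
Qed.

(** * Graphs attaining the energy bound *)

Theorem corollary1p3 (C : numClosedFieldType) (n : nat) (e : rel 'I_n)
    (e_sym : symmetric e) (e_irr : irreflexive e) :
  let bound : C := n%:R * sqrtC n%:R / 2 + n%:R / 2 in
  let H : 'M[C]_n := 2 *: adjacency_mx C e - const_mx 1 in
  energy C e <= bound /\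
  (energy C e = bound <->
   [/\ hadamard_mx H, H^T = H, forall i, H i i = -1, regular_mx H &
       forall i, 0 < \sum_j H i j]).
Proof.
move=> bound H.
have AH : 2 *: adjacency_mx C e = H + const_mx 1 by rewrite subrK.
have HE i j : H i j = if e i j then 1 else -1.
  by rewrite !mxE; case: (e i j); rewrite ?mulr0 ?add0r ?mulr1 //; ring.
clearbody H.
have H1 i j : `|H i j| = 1 by rewrite HE; case: ifP; rewrite ?normrN normr1.
have HT : H^T = H by apply/matrixP => i j; rewrite mxE !HE e_sym.
have Hadj : H^t* = H.
  rewrite HT; apply/matrixP => i j; rewrite mxE HE.
  by case: ifP => _; rewrite ?rmorphN rmorph1.
split; first exact: trace_norm_sign_le AH H1.
apply: (iff_trans (trace_norm_sign_eq AH H1)); rewrite Hadj.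
have row_sumE i : \sum_j H i j = (H *m (const_mx 1 : 'cV_n)) i 0.
  by rewrite mxE; apply: eq_bigr => j _; rewrite mxE mulr1.
have col_sumE j : \sum_i H i j = \sum_i H j i.
  by apply: eq_bigr => i _; rewrite -[in LHS]HT mxE.
split=> [[HH H_one] | [[_ HH] _ _ [row_eq _] row_gt0]].
  have row_sum i : \sum_j H i j = sqrtC n%:R.
    by rewrite row_sumE H_one !mxE mulr1.
  split=> //; first by split=> //; rewrite Hadj.
  - by move=> i; rewrite HE e_irr.
  - by split=> i j; rewrite ?col_sumE !row_sum.
  - by move=> i; rewrite row_sum sqrtC_gt0 ltr0n (leq_ltn_trans (leq0n i)).
rewrite Hadj in HH; split=> //; apply/colP => i.
rewrite -row_sumE !mxE mulr1; set r := \sum_j _.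
have H_one : H *m (const_mx 1 : 'cV_n) = r *: const_mx 1.
  by apply/colP => k; rewrite -row_sumE (row_eq k i) !mxE mulr1.
(* The two values of H (H 1): r^2 1 by regularity and n 1 since H^2 = n I. *)
have : r ^+ 2 = n%:R.
  have := congr1 (fun M : 'M_n => (M *m (const_mx 1 : 'cV_n)) i 0) HH.
  rewrite -mulmxA H_one -scalemxAr H_one scalerA mul_scalar_mx !mxE !mulr1.
  by rewrite -expr2.
by move=> <-; rewrite sqrCK // (ltW (row_gt0 i)).
Qed.
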